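(* Let $G=\operatorname{GL}_2(q)$, where $q$ is a prime power. Then there exist irreducible rational representations $\rho$ and $\theta$ of $G$ (that is, irreducible representations over $\mathbb{Q}$), each of degree greater than one, such that $\rho\otimes_{\mathbb{Q}}\theta$ is also an irreducible rational representation of $G$.
   Formalization: The prime power q is required to be greater than 3, because the claim fails for q = 2 and q = 3: no two irreducible rational representations of degree greater than one of GL_2(2) or GL_2(3) have an irreducible tensor product. *)

(* Defs.v *)
From HB Require Import structures.
From mathcomp Require Export all_boot all_order all_algebra all_fingroup.
From mathcomp Require Export all_solvable all_field all_character.

(* Representations are matrix representations acting on row vectors; the
   degree is the size of the matrices, and the tensor product is [prod_repr]
   (Kronecker product).  [mx_irreducible] is irreducibility over the field of
   coefficients, here [rat], and not absolute irreducibility. *)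

Set Implicit Arguments.
Unset Strict Implicit.
Unset Printing Implicit Defensive.

(* Main.v *)
(* Take for [rho] the Steinberg representation, the sum-zero part of the
   permutation representation on the projective line, and for [theta] a rational
   constituent of degree > 1 of a representation factoring through the
   determinant; it exists because some unit of F has a square different from 1
   (as q > 3), whereas group elements act on rational lines by 1 or -1.  SL_2 is
   2-transitive on the projective line, so [rho] is absolutely irreducible on
   SL_2, where [theta] is trivial.  Hence the enveloping algebra of the tensor
   product contains all A (x) 1, thus also all 1 (x) theta(g), and a nonzero
   submodule is everything because [theta] is irreducible. *)
From HB Require Import structures.
From Stdlib Require Classical_Prop.
Require Import Defs.
From mathcomp Require Import ring.

Set Implicit Arguments.
Unset Strict Implicit.
Unset Printing Implicit Defensive.

Import GRing.Theory Num.Theory.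
Local Open Scope ring_scope.

(** * Tensor products of representations *)

Lemma tprod_is_linear (R : fieldType) m1 n1 m2 n2 (B : 'M[R]_(m2, n2)) :
  linear (fun A : 'M[R]_(m1, n1) => tprod A B).
Proof.
elim: m1 n1 => [|m1 IH] n1 c A1 A2 /=; first by rewrite scaler0 add0r.
by rewrite -!trowbE !linearP /= IH scale_col_mx add_col_mx.
Qed.

Lemma tprod_suml (R : fieldType) m1 n1 m2 n2 (B : 'M[R]_(m2, n2)) (I : finType)
    (P : pred I) (a : I -> R) (A : I -> 'M[R]_(m1, n1)) :
  tprod (\sum_(i | P i) a i *: A i) B = \sum_(i | P i) a i *: tprod (A i) B.
Proof.
pose f_lin := GRing.isLinear.Build _ _ _ _ _ (@tprod_is_linear R m1 n1 m2 n2 B).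
pose f : {linear _ -> _} := HB.pack (fun A : 'M[R]_(m1, n1) => tprod A B) f_lin.
by rewrite -[LHS]/(f _) linear_sum; apply: eq_bigr => i _; rewrite linearZ.
Qed.

(** The sizes [1 * n] and [n] are equal but not convertible, so the identification is carried by an
    invertible intertwiner [P] instead of casts. *)
Lemma tprod_scalar1 (R : fieldType) n :
  exists P : 'M[R]_(1 * n, n), exists Q : 'M[R]_(n, 1 * n),
    P *m Q = 1%:M /\ forall B, tprod (1%:M : 'M_1) B *m P = P *m B.
Proof.
have castP n' (e : n = n') : exists P : 'M[R]_(n', n), exists Q : 'M[R]_(n, n'),
    P *m Q = 1%:M /\ forall B, castmx (e, e) B *m P = P *m B.
  case: _ / e; exists 1%:M, 1%:M; split; rewrite ?mulmx1 // => B.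
  by rewrite castmx_id mulmx1 mul1mx.
have [P [Q [PQ cP]]] := castP _ (esym (mul1n n)).
exists P, Q; split=> // B; rewrite -cP; congr (_ *m _).
apply/matrixP=> i j; rewrite castmxE /=.
rewrite !mxE; case: splitP => [i' ei|[]//].
rewrite mxE; case: splitP => [j' ej|[]//].
by rewrite !mxE eqxx mul1r; congr (B _ _); apply: val_inj.
Qed.

Lemma prod_repr_irr (R : fieldType) (gT : finGroupType) (G H : {group gT})
    (sHG : H \subset G) m n (theta : mx_representation R G m)
    (rho : mx_representation R G n) :
  mx_absolutely_irreducible (subg_repr theta sHG) ->
  mx_irreducible rho -> {in H, forall x, rho x = 1%:M} ->
  mx_irreducible (prod_repr theta rho).
Proof.
case/mx_abs_irrP=> m_gt0 [a a_theta] /mx_irrP[n_gt0 irr_rho] rhoH.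
apply/mx_irrP; split=> [|U /mxmoduleP modU nzU]; first by rewrite muln_gt0 m_gt0.
(* Absolute irreducibility on [H] makes [A] a combination of matrices [theta x] with [x] in [H], and
   there [rho x] is the identity. *)
have UL A : (U *m tprod A 1%:M <= U)%MS.
  rewrite [A]a_theta tprod_suml mulmx_sumr summx_sub // => x Hx.
  by rewrite -scalemxAr scalemx_sub //= -(rhoH x Hx) modU ?(subsetP sHG).
have UR x : x \in G -> (U *m tprod (1%:M) (rho x) <= U)%MS.
  move=> Gx; have -> : 1%:M = theta x *m theta x^-1%g.
    by rewrite -repr_mxM ?groupV // mulgV repr_mx1.
  rewrite -[rho x]mulmx1 tprodE mulmxA.
  exact: submx_trans (submxMr _ (modU x Gx)) (UL _).
(* [E k] and [F k] are the inclusion of and the projection onto the [k]-th of the [m] blocks of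
   length [n]. *)
pose E k : 'M[R]_(1 * n, m * n) := tprod (delta_mx 0 k : 'rV_m) 1%:M.
pose F k : 'M[R]_(m * n, 1 * n) := tprod (delta_mx k 0 : 'cV_m) 1%:M.
have FE k l : F k *m E l = tprod (delta_mx k l) 1%:M.
  by rewrite -tprodE mul_delta_mx mulmx1.
have sumFE : \sum_k F k *m E k = 1%:M.
  rewrite -tprod1 [X in tprod X](_ : _ = \sum_(k | true) 1 *: delta_mx k k).
    by rewrite tprod_suml; apply: eq_bigr => k _; rewrite FE scale1r.
  apply/matrixP=> i j; rewrite summxE (bigD1 i) //= big1 => [|k neq_ki].
    by rewrite !mxE eqxx mul1r addr0 eq_sym.
  by rewrite !mxE eq_sym (negPf neq_ki) mulr0.
have [k nzUF] : exists k, U *m F k != 0.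
  apply/existsP; apply: contraR nzU => /existsPn UF0.
  rewrite -[U]mulmx1 -sumFE mulmx_sumr big1 // => k _.
  by have := UF0 k; rewrite negbK mulmxA => /eqP->; rewrite mul0mx.
have [P [Q [PQ cP]]] := tprod_scalar1 R n.
pose W := U *m F k *m P.
have modW : mxmodule rho <<W>>%MS.
  apply/mxmoduleP=> x Gx; rewrite (eqmxMr _ (genmxE _)) genmxE /W.
  rewrite -mulmxA -cP !mulmxA submxMr // -mulmxA -tprodE mulmx1 mul1mx.
  rewrite -[delta_mx k 0]mul1mx -[rho x]mulmx1 tprodE mulmxA submxMr //.
  exact: UR.
have nzW : <<W>>%MS != 0.
  rewrite -mxrank_eq0 genmxE mxrank_eq0; apply: contra nzUF => /eqP W0.
  by rewrite -[U *m F k]mulmx1 -PQ mulmxA -/W W0 mul0mx.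
have : (P <= W)%MS by rewrite -(genmxE W) submx_full ?irr_rho.
case/submxP=> D eP; have D1 : D *m U *m F k = 1%:M.
  by rewrite -PQ [in RHS]eP /W !mulmxA -[RHS]mulmxA PQ mulmx1.
(* Since [D *m U *m F k] is the identity, [E l] equals [D *m U *m tprod (delta_mx k l) 1%:M], which
   lies in [U] by [UL]. *)
rewrite -sub1mx -sumFE summx_sub // => l _; apply: mulmx_sub.
rewrite -[E l]mul1mx -D1 -[_ *m F k *m _]mulmxA FE -mulmxA.
exact: mulmx_sub.
Qed.

(** * Constituents of degree greater than one *)

(** By Maschke the module is a sum of simple ones. If all were lines, [x] would act on each by a
    root of unity of the ordered field, so by a sign, and [x ^+ 2] would act trivially. *)
Lemma exists_nonlinear_constituent (R : realFieldType) (gT : finGroupType)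
    (G : {group gT}) n (rG : mx_representation R G n) (x : gT) :
  x \in G -> (x ^+ 2)%g \notin rker rG ->
  exists2 U : 'M_n, mxsimple rG U & (1 < \rank U)%N.
Proof.
move=> Gx nt_x2.
have redG : mx_completely_reducible rG 1%:M.
  apply: mx_Maschke_pchar; rewrite /pgroup pcharf'_nat pnatr_eq0 -lt0n.
  exact: cardG_gt0.
(* The semisimple decomposition is only given under [classically], which can be opened for a boolean
   goal such as [false]. *)
apply: Classical_Prop.NNPP => noU; suff : false by [].
apply: (mx_reducible_semisimple (mxmodule1 rG) redG) => -[I U W simU defW _].
case/rkerP: nt_x2; rewrite groupX //; split=> //.
rewrite -(repr_mx1 rG) -(expg0 x); apply/eqP; rewrite -subr_eq0 -[_ - _]mul1mx.
rewrite -submx0 -(eqmxMr _ defW) sumsmxMr.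
apply/sumsmx_subP=> i _; have [modU nzU _] := simU i.
have rU : (\rank (U i) <= 1)%N.
  by rewrite leqNgt; apply/negP=> rU; case: noU; exists (U i).
have nz_u := nzU; rewrite -nz_row_eq0 in nz_u; set u := nz_row (U i) in nz_u.
have defu : (u :=: U i)%MS.
  apply/eqmxP; rewrite -mxrank_leqif_eq ?nz_row_sub // eqn_leq.
  by rewrite mxrankS ?nz_row_sub // (leq_trans rU) // lt0n mxrank_eq0.
have /sub_rVP[c uc] : (u *m rG x <= u)%MS.
  by rewrite defu mxmodule_trans ?nz_row_sub.
have ucn k : u *m rG (x ^+ k)%g = c ^+ k *: u.
  elim: k => [|k IH]; first by rewrite repr_mx1 mulmx1 scale1r.
  by rewrite expgSr repr_mxM ?groupX // mulmxA IH -scalemxAl uc scalerA exprSr.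
(* A root of unity in an ordered field is 1 or -1. *)
have c2 : c ^+ 2 = 1.
  have : c ^+ #[x]%g *: u = 1 *: u.
    by rewrite -ucn expg_order repr_mx1 mulmx1 scale1r.
  move/eqP; rewrite -subr_eq0 -scalerBl scaler_eq0 (negPf nz_u) orbF subr_eq0.
  move/eqP/(congr1 Num.norm); rewrite normrX normr1 => /eqP.
  rewrite pexpr_eq1 ?order_gt0 // => /eqP c1.
  by rewrite -real_normK ?num_real // c1 expr1n.
by rewrite -(eqmxMr _ defu) mulmxBr !ucn c2 subrr sub0mx.
Qed.

(** * Permutation representations and their sum-zero part *)

Section ActionRepr.

Variables (R : fieldType) (gT : finGroupType) (X : finType).
Variable to : {action gT &-> X}.

Definition action_mx (g : gT) : 'M[R]_#|X| :=
  \matrix_(i, j) (to (enum_val i) g == enum_val j)%:R.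

Lemma action_mx_mul p g (A : 'M_(#|X|, p)) i j :
  (action_mx g *m A) i j = A (enum_rank (to (enum_val i) g)) j.
Proof.
rewrite mxE (bigD1 (enum_rank (to (enum_val i) g))) //= big1 => [|k neq_k].
  by rewrite !mxE enum_rankK eqxx mul1r addr0.
rewrite !mxE; case: eqP => [ek|_]; last by rewrite mul0r.
by rewrite ek enum_valK eqxx in neq_k.
Qed.

Lemma action_mx_repr (G : {group gT}) : mx_repr G action_mx.
Proof.
split=> [|g h _ _]; apply/matrixP=> i j.
  by rewrite !mxE act1 (inj_eq enum_val_inj).
by rewrite action_mx_mul !mxE enum_rankK actM.
Qed.

Canonical action_repr G := MxRepresentation (action_mx_repr G).

Lemma action_mx_faithful g : action_mx g = 1%:M -> forall x, to x g = x.
Proof.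
move/matrixP=> g1 x; have := g1 (enum_rank x) (enum_rank x).
by rewrite !mxE !enum_rankK !eqxx; case: eqP => // _ /eqP; rewrite eq_sym oner_eq0.
Qed.

Lemma action_mx_triv g : (forall x, to x g = x) -> action_mx g = 1%:M.
Proof.
by move=> g1; apply/matrixP=> i j; rewrite !mxE g1 (inj_eq enum_val_inj).
Qed.

Definition sum0_mx : 'M[R]_#|X| := kermx (const_mx 1 : 'cV_#|X|).

Lemma action_mx_const g : action_mx g *m const_mx 1 = const_mx 1 :> 'cV_#|X|.
Proof. by apply/matrixP=> i j; rewrite action_mx_mul !mxE. Qed.

Lemma sum0_mx_module (G : {group gT}) : mxmodule (action_repr G) sum0_mx.
Proof.
apply/mxmoduleP=> g _; apply/sub_kermxP.
by rewrite -mulmxA action_mx_const; apply: mulmx_ker.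
Qed.

Definition sum0_repr G := submod_repr (sum0_mx_module G).

Lemma rank_sum0_mx : (#|X|.-1 <= \rank sum0_mx)%N.
Proof. by rewrite mxrank_ker -subn1 leq_sub2l ?rank_leq_col. Qed.

(** The hypothesis treats equal and distinct pairs together, so this combines transitivity with
    2-transitivity. *)
Definition transitive_on_pairs (H : {set gT}) :=
  forall x y x' y' : X, (x == y) = (x' == y') ->
  exists2 g, g \in H & to x g = x' /\ to y g = y'.

(** The sum counts the elements of [H] taking [i] to [j] and [k] to [l]. By transitivity the count
    is the order of a point stabilizer if [i = k] and [j = l], that of a two-point stabilizer if
    both differ, and 0 otherwise. These values are [e - c], [c] and 0. *)
Lemma sum_action_mx2 (H : {group gT}) :
    transitive_on_pairs H -> (1 < #|X|)%N ->
  exists e c : nat, (0 < e)%N /\ forall i j k l,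
    \sum_(g in H) action_mx g i j * action_mx g k l
      = e%:R * (i == k)%:R * (j == l)%:R
        + c%:R * (1 - (i == k)%:R - (j == l)%:R).
Proof.
move=> trH /card_gt1P[x0 [x1 [_ _ neq01]]].
pose S x y u v := [set g in H | (to x g == y) && (to u g == v)].
pose K x y u v := #|S x y u v|.
(* The map from [g] to [h^-1 * g * k] is a bijection between the two sets counted. *)
have Kinv x y u v h k : h \in H -> k \in H ->
    K (to x h) (to y k) (to u h) (to v k) = K x y u v.
  move=> Hh Hk; rewrite /K -(card_lcoset (S x y u v) h^-1%g).
  rewrite -[RHS](card_rcoset _ k); apply: eq_card => g.
  have eqk z w : (to z g == to w k) = (to z (g * k^-1)%g == w).
    by rewrite actM -[RHS](inj_eq (act_inj to k)) actKV.
  rewrite mem_rcoset mem_lcoset invgK !inE !eqk -!actM.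
  by rewrite groupMl // groupMr ?groupV.
have Kpair x y u v : (x == u) = (y == v) ->
    K x y u v = if x == u then K x0 x0 x0 x0 else K x0 x0 x1 x1.
  move=> eq_xu; pose z := if x == u then x0 else x1.
  have eq_z : (x0 == z) = (x == u).
    by rewrite /z; case: ifP; rewrite ?eqxx // (negPf neq01).
  have [h Hh [<- <-]] := trH _ _ _ _ eq_z.
  have [k Hk [<- <-]] := trH _ _ _ _ (etrans eq_z eq_xu).
  by rewrite Kinv // (inj_eq (act_inj to h)) eq_z /z; case: ifP.
exists (K x0 x0 x0 x0 + K x0 x0 x1 x1)%N, (K x0 x0 x1 x1); split.
  by rewrite addn_gt0; apply/orP; left; apply/card_gt0P; exists 1%g;
     rewrite !inE group1 act1 eqxx.
move=> i j k l.
transitivity ((K (enum_val i) (enum_val j) (enum_val k) (enum_val l))%:R : R).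
  rewrite /K -sum1_card natr_sum big_mkcond [RHS]big_mkcond /=.
  apply: eq_bigr => g _; rewrite !inE !mxE -natrM mulnb.
  by case: (g \in H) => //=; case: (_ && _).
have [eq_ijkl|neq_ijkl] := eqVneq (i == k) (j == l).
  rewrite Kpair ?(inj_eq enum_val_inj) // eq_ijkl natrD.
  by case: (j == l); rewrite /= ?mulr1n ?mulr0n; ring.
have -> : K (enum_val i) (enum_val j) (enum_val k) (enum_val l) = 0%N.
  apply/eqP; rewrite cards_eq0; apply/eqP/setP=> g; rewrite !inE.
  apply/negbTE; apply: contra neq_ijkl => /and3P[_ /eqP eij /eqP ekl].
  rewrite -(inj_eq enum_val_inj i) -(inj_eq enum_val_inj j) -eij -ekl.
  by rewrite (inj_eq (act_inj to g)).
by move: neq_ijkl; case: (i == k); case: (j == l) => //= _;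
   rewrite ?mulr1n ?mulr0n; ring.
Qed.

(* An endomorphism [A] of the sum-zero module extends to a matrix [M] whose rows
   sum to zero.  In the sum over [g] of [tr (M (action_mx g)^T) action_mx g], the
   [c]-terms of [sum_action_mx2] cancel on sum-zero vectors, leaving [e A]. *)
Lemma sum0_abs_irr (G H : {group gT}) (sHG : H \subset G) :
    [pchar R] =i pred0 -> transitive_on_pairs H -> (1 < #|X|)%N ->
  mx_absolutely_irreducible (subg_repr (sum0_repr G) sHG).
Proof.
move=> /pcharf0P ch0 trH X_gt1; apply/mx_abs_irrP.
have [e [c [e_gt0 sumH]]] := sum_action_mx2 trH X_gt1.
split; first by apply: leq_trans rank_sum0_mx; rewrite -subn1 subn_gt0.
pose iota : 'M_(_, #|X|) := val_submod (1%:M : 'M_(\rank sum0_mx)).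
pose M (A : 'M_(\rank sum0_mx)) := in_submod sum0_mx 1%:M *m A *m iota.
have iota_sum i : \sum_u iota i u = 0.
  have : (iota *m (const_mx 1 : 'cV_#|X|)) i 0 = 0.
    have /sub_kermxP-> : (iota <= sum0_mx)%MS by apply: val_submodP.
    by rewrite mxE.
  by rewrite mxE; under eq_bigr do rewrite [const_mx _ _ _]mxE mulr1.
have M_sum A x : \sum_y M A x y = 0.
  have eM y : M A x y = \sum_k (in_submod sum0_mx 1%:M *m A) x k * iota k y.
    by rewrite /M mxE.
  under eq_bigr do rewrite eM.
  rewrite exchange_big big1 //= => k _.
  by rewrite -mulr_sumr iota_sum mulr0.
have iotaM A : iota *m M A = A *m iota.
  by rewrite /M -(mulmxA _ A) (mulmxA iota) -in_submodE val_submodK mul1mx.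
exists (fun g A => e%:R^-1 * \sum_x \sum_y M A x y * action_mx g x y) => A.
have deltaR (f : 'I_#|X| -> R) l : \sum_j f j * (j == l)%:R = f l.
  rewrite (bigD1 l) //= big1 => [|j /negPf->]; last by rewrite mulr0.
  by rewrite eqxx mulr1 addr0.
have sumMH u v : \sum_x \sum_y M A x y *
    (\sum_(g in H) action_mx g x y * action_mx g u v)
      = e%:R * M A u v - c%:R * \sum_x M A x v.
  rewrite -[M A u v](deltaR (fun x => M A x v)) !mulr_sumr -sumrB.
  apply: eq_bigr => x _.
  (* The terms are grouped by their dependence on [y]: the first group vanishes by [M_sum], the
     second is evaluated by [deltaR]. *)
  transitivity (\sum_y (c%:R * (1 - (x == u)%:R) * M A x y
      + (e%:R * (x == u)%:R - c%:R) * (M A x y * (y == v)%:R))).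
    by apply: eq_bigr => y _; rewrite sumH; ring.
  by rewrite big_split -!mulr_sumr /= M_sum deltaR; ring.
rewrite -[LHS]val_submodK val_submodE -/iota -iotaM.
transitivity (in_submod sum0_mx (\sum_(g in H) (e%:R^-1 *
    \sum_x \sum_y M A x y * action_mx g x y) *: (iota *m action_mx g))).
  congr in_submod; apply/matrixP=> i v; rewrite summxE.
  transitivity (e%:R^-1 * \sum_u iota i u * \sum_x \sum_y M A x y *
      (\sum_(g in H) action_mx g x y * action_mx g u v)).
    (* The [c]-term of [sumMH] does not depend on [u], so it vanishes against the row [iota i],
       whose sum is 0. *)
    under eq_bigr do rewrite sumMH mulrBr.
    rewrite sumrB -mulr_suml iota_sum mul0r subr0 mxE mulr_sumr.
    by apply: eq_bigr => u _; rewrite mulrCA mulKf // ch0 -lt0n.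
  under [RHS]eq_bigr do rewrite mxE [X in _ * X]mxE -mulrA mulr_sumr.
  rewrite -mulr_sumr exchange_big; congr (_ * _); apply: eq_bigr => u _ /=.
  under [RHS]eq_bigr do rewrite mulrCA.
  rewrite -mulr_sumr; congr (_ * _).
  under [RHS]eq_bigr do rewrite mulr_suml.
  rewrite [RHS]exchange_big; apply: eq_bigr => x _ /=.
  under [RHS]eq_bigr do rewrite mulr_suml.
  rewrite [RHS]exchange_big; apply: eq_bigr => y _ /=.
  by rewrite mulr_sumr; apply: eq_bigr => g _; rewrite mulrA.
by rewrite linear_sum; apply: eq_bigr => g _; rewrite linearZ.
Qed.

End ActionRepr.

(** * The projective line and the actions of GL_2 *)

Lemma det_mx22 (R : comPzRingType) (A : 'M[R]_2) :
  \det A = A 0 0 * A 1 1 - A 0 1 * A 1 0.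
Proof.
rewrite (expand_det_row A 0) !big_ord_recl big_ord0 /cofactor !det_mx11 !mxE.
have -> : lift 0 0 = 1 :> 'I_2 by apply: val_inj.
have -> : lift 1 0 = 0 :> 'I_2 by apply: val_inj.
by rewrite /= /bump /= expr0 expr1 mul1r mulN1r addr0 mulrN.
Qed.

Section ProjectiveLine.

Variable F : finFieldType.

(* [Some a] stands for the point [a : 1] and [None] for the point [1 : 0]. *)
Definition line_vec (x : option F) : 'rV[F]_2 :=
  if x is Some a then \row_i (if i == 0 then a else 1) else delta_mx 0 0.

(** The zero vector, which spans no line, gets the default value [None]. *)
Definition vec_line (v : 'rV[F]_2) : option F :=
  if v 0 1 == 0 then None else Some (v 0 0 / v 0 1).

Lemma vec_lineK v : v != 0 ->
  exists2 c, c != 0 & line_vec (vec_line v) = c *: v.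
Proof.
have rowP2 (u w : 'rV[F]_2) : u 0 0 = w 0 0 -> u 0 1 = w 0 1 -> u = w.
  move=> e0 e1; apply/rowP=> i; case: (unliftP 0 i) => [j ->|-> //].
  by rewrite [j]ord1 (_ : lift 0 0 = 1) //; apply: val_inj.
move=> nz_v; rewrite /vec_line; case: eqVneq => [v1|nz_v1].
  have nz_v0 : v 0 0 != 0.
    by apply: contra nz_v => /eqP v0; apply/eqP; apply: rowP2; rewrite ?v0 ?v1 mxE.
  exists (v 0 0)^-1; first by rewrite invr_eq0.
  by apply: rowP2; rewrite !mxE ?mulVf ?v1 ?mulr0.
exists (v 0 1)^-1; first by rewrite invr_eq0.
by apply: rowP2; rewrite !mxE ?mulVf // mulrC.
Qed.

Lemma vec_lineZ c v : c != 0 -> vec_line (c *: v) = vec_line v.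
Proof.
move=> nz_c; rewrite /vec_line !mxE mulf_eq0 (negPf nz_c) /=.
by case: eqP => // _; rewrite -mulf_div divff ?mul1r.
Qed.

Lemma line_vecK : cancel line_vec vec_line.
Proof. by case=> [a|]; rewrite /vec_line !mxE /= ?oner_eq0 ?divr1 ?eqxx. Qed.

Lemma line_vec_neq0 x : line_vec x != 0.
Proof.
apply/eqP=> /rowP x0; case: x x0 => [a /(_ 1)|/(_ 0)]; rewrite !mxE /=.
  by move/eqP; rewrite oner_eq0.
by move/eqP; rewrite oner_eq0.
Qed.

Lemma GL_row_neq0 (g : {'GL_2[F]}) (v : 'rV_2) : v != 0 -> v *m GLval g != 0.
Proof.
apply: contra => /eqP vg0; rewrite -[v](mulmxK (GL_unitmx g)) vg0.
by rewrite mul0mx.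
Qed.

Definition line_act (x : option F) (g : {'GL_2[F]}) : option F :=
  vec_line (line_vec x *m GLval g).

Lemma line_act1 : line_act^~ 1%g =1 id.
Proof. by move=> x; rewrite /line_act GL_1E mulmx1 line_vecK. Qed.

Lemma line_actM x : act_morph line_act x.
Proof.
move=> g h; rewrite /line_act.
have [c nz_c ->] := vec_lineK (GL_row_neq0 g (line_vec_neq0 x)).
by rewrite GL_MxE -scalemxAl vec_lineZ // mulmxA.
Qed.

Definition line_action := TotalAction line_act1 line_actM.

Lemma exists_GL2 (C : 'M[F]_2) :
  \det C != 0 -> exists g : {'GL_2[F]}, GLval g = C.
Proof.
rewrite -unitfE -unitmxE => C_unit.
by exists (Sub C C_unit : {'GL_2[F]}); apply: SubK.
Qed.

Lemma GL2_det_surj (a : F) :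
  a != 0 -> exists g : {'GL_2[F]}, \det (GLval g) = a.
Proof.
move=> nz_a; pose C : 'M[F]_2 := diag_mx (\row_i (if i == 0 then a else 1)).
have detC : \det C = a.
  by rewrite det_diag !big_ord_recl big_ord0 !mxE /= !mulr1.
have [g gC] : exists g : {'GL_2[F]}, GLval g = C by apply: exists_GL2; rewrite detC.
by exists g; rewrite gC.
Qed.

(** The action is on all of [F] and not just on its units, which avoids a subtype; the fixed point 0
    only contributes a trivial constituent. *)
Definition det_act (a : F) (g : {'GL_2[F]}) := a * \det (GLval g).

Lemma det_act1 : det_act^~ 1%g =1 id.
Proof. by move=> a; rewrite /det_act GL_1E det1 mulr1. Qed.

Lemma det_actM a : act_morph det_act a.
Proof. by move=> g h; rewrite /det_act GL_MxE det_mulmx mulrA. Qed.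

Definition det_action := TotalAction det_act1 det_actM.

Definition SL2 := [set g : {'GL_2[F]} | \det (GLval g) == 1].

Lemma SL2_group_set : group_set SL2.
Proof.
apply/group_setP; split=> [|g h]; first by rewrite inE GL_1E det1.
by rewrite !inE GL_MxE det_mulmx => /eqP-> /eqP->; rewrite mulr1.
Qed.

Canonical SL2_group := Group SL2_group_set.

(** Two distinct points give a basis, and a change of basis takes one pair to the other. Scaling one
    target vector by [d] makes its determinant 1 and leaves the target lines unchanged. *)
Lemma line_action_transitive_on_pairs : transitive_on_pairs line_action SL2.
Proof.
pose rows (u w : 'rV[F]_2) : 'M_2 := \matrix_i (if i == 0 then u else w).
have det_rows u w : \det (rows u w) = u 0 0 * w 0 1 - u 0 1 * w 0 0.
  by rewrite det_mx22 !mxE.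
have nz_det x y : x != y -> \det (rows (line_vec x) (line_vec y)) != 0.
  rewrite det_rows; case: x y => [a|] [b|] // neq_ab; rewrite !mxE /=.
  - by rewrite mulr1 mul1r subr_eq0; apply: contra neq_ab => /eqP->.
  - by rewrite mulr0 mul1r sub0r oppr_eq0 oner_eq0.
  - by rewrite mul1r mul0r subr0 oner_eq0.
have trans2 x y x' y' : x != y -> x' != y' ->
    exists2 g, g \in SL2 & line_action x g = x' /\ line_action y g = y'.
  move=> neq_xy neq_xy'.
  set B := rows (line_vec x) (line_vec y).
  set B' := rows (line_vec x') (line_vec y').
  pose d := \det B / \det B'.
  have nzB : \det B != 0 by apply: nz_det.
  have nzB' : \det B' != 0 by apply: nz_det.
  have nz_d : d != 0 by rewrite mulf_neq0 ?invr_eq0.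
  have B_unit : B \in unitmx by rewrite unitmxE unitfE.
  pose C := invmx B *m rows (d *: line_vec x') (line_vec y').
  have detC : \det C = 1.
    rewrite det_mulmx det_inv (_ : \det (rows (d *: _) _) = d * \det B').
      by rewrite [d * _]divfK // mulVf.
    by rewrite !det_rows mulrBr !mulrA !mxE.
  have [g gC] : exists g : {'GL_2[F]}, GLval g = C.
    by apply: exists_GL2; rewrite detC oner_eq0.
  have gE (i : 'I_2) : row i B *m GLval g
      = row i (rows (d *: line_vec x') (line_vec y')).
    by rewrite gC /C -row_mul mulmxA mulmxV ?mul1mx.
  exists g; first by rewrite inE gC detC.
  split; rewrite /= /line_act.
    by have := gE 0; rewrite !rowK => ->; rewrite vec_lineZ ?line_vecK.
  by have := gE 1; rewrite !rowK => ->; rewrite line_vecK.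
have other (x : option F) : exists y, x != y.
  by case: x => [a|]; [exists None | exists (Some 0)].
move=> x y x' y'; have [->|neq_xy] := eqVneq x y; last first.
  by move/esym/negbT; apply: trans2.
(* For equal points, source and target are each completed to a distinct pair. *)
have [z neq_yz] := other y; have [z' neq_xz'] := other x'.
move/esym/eqP=> <-; have [g SLg [gy _]] := trans2 _ _ _ _ neq_yz neq_xz'.
by exists g.
Qed.

End ProjectiveLine.

(* The irreducible tensor product for GL_2 *)
Local Close Scope ring_scope.

(* The bound 3 < q is needed: the conclusion fails for GL_2(2) and GL_2(3). *)
Theorem corollary5p3 (p k q : nat) (F : finFieldType)
    (p_prime : prime p) (k_gt0 : 0 < k) (q_def : q = p ^ k) (q_gt3 : 3 < q)
    (cardF : #|F| = q) :
  exists (m n : nat)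
         (rho : mx_representation rat 'GL_2[F]%G m)
         (theta : mx_representation rat 'GL_2[F]%G n),
    [/\ 1 < m, 1 < n, mx_irreducible rho, mx_irreducible theta
      & mx_irreducible (prod_repr rho theta)].
Proof.
have char0 : [pchar rat]%R =i pred0 := pchar_num rat.
have card_line : #|{: option F}| = q.+1 by rewrite card_option cardF.
have sSLG : SL2_group F \subset 'GL_2[F]%G by apply: subsetT.
have abs_rho : mx_absolutely_irreducible
    (subg_repr (sum0_repr rat (line_action F) 'GL_2[F]%G) sSLG).
  apply: sum0_abs_irr char0 (@line_action_transitive_on_pairs F) _.
  by rewrite card_line ltnS (ltn_trans _ q_gt3).
have [a /andP[nz_a a2]|small_F] := pickP (fun a : F => (a != 0) && (a ^+ 2 != 1))%R;
    last first.
  (* If every nonzero element squares to 1, then [F] lies in {0, 1, -1}. *)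
  suff : #|F| <= 3 by rewrite cardF leqNgt q_gt3.
  rewrite -cardsT (leq_trans (subset_leq_card (_ : _ \subset [set 0; 1; -1]%R))) //.
    apply/subsetP=> a _; have := small_F a; rewrite !inE sqrf_eq1 -orbA.
    by case: (a == 0%R) => //= /negbFE.
  by rewrite -setUA cardsU1 cards2; case: (_ \in _); case: (_ == _).
pose D := action_repr rat (det_action F) 'GL_2[F]%G.
have [g det_g] := GL2_det_surj nz_a.
have Gg : g \in 'GL_2[F]%G by rewrite inE.
have ker_g2 : (g ^+ 2)%g \notin rker D.
  (* The element [g ^+ 2] moves the point 1 to [a ^+ 2], which differs from 1. *)
  apply/rkerP=> -[_ /action_mx_faithful/(_ 1%R)].
  rewrite /= /det_act mul1r GL_MxE det_mulmx det_g => /eqP.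
  by rewrite (negPf a2).
have [U simU rU] := exists_nonlinear_constituent Gg ker_g2.
have modU := mxsimple_module simU.
have irr_theta : mx_irreducible (submod_repr modU) by apply/submod_mx_irr.
exists _, _, (sum0_repr rat (line_action F) 'GL_2[F]%G), (submod_repr modU).
split=> //.
- by apply: leq_trans (rank_sum0_mx _ _); rewrite card_line ltnW // ltnW.
- exact: subg_mx_irr (mx_abs_irrW abs_rho).
apply: prod_repr_irr abs_rho irr_theta _ => h.
rewrite inE => /eqP det_h; have Dh : D h = 1%:M%R.
  by apply: action_mx_triv => b; rewrite /= /det_act det_h mulr1.
by rewrite /= /submod_mx Dh mulmx1 val_submodK.
Qed.
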